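(* Let $n\ge1$. The affine variety $\mathbf V(Q_n)=\{\mu\in\mathbb R^n:Q_n(\mu)=0\}$ is a disjoint union of $n$ smooth $(n-1)$-dimensional surfaces $$\mathbf V(Q_n)=\bigcup_{k=0}^{n-1}\Gamma_k^{(n-1)},\qquad \Gamma_k^{(n-1)}=\mathrm{Graph}\big(\Phi_{n-1}|_{D_k^{(n-1)}}\big),\quad k=0,\dots,n-1.$$ Moreover, the complement of $\mathbf V(Q_n)$ in $\mathbb R^n$ is the disjoint union of $n+1$ unbounded open connected components $$(\mathbf V(Q_n))^c=\bigcup_{k=0}^nD_k^{(n)}.$$
   Context: The real polynomials $Q_n=Q_n(\mu_1,\dots,\mu_n)$ are defined by $Q_0=1$, $Q_1(\mu_1)=1+\mu_1$, and $Q_{n+1}=(2+\mu_{n+1})Q_n-Q_{n-1}$ for $n\ge1$. For $n\ge 1$, $\Phi_n=Q_{n-1}/Q_n-2$ with domain $\mathrm{Dom}(\Phi_n)=\{\mu\in\mathbb R^n: Q_n(\mu)\neq0\}$. For a real function $f$, $\mathrm{epi}(f)=\{(x,y)\in\mathrm{Dom}(f)\times\mathbb R: y>f(x)\}$ and $\mathrm{hypo}(f)=\{(x,y)\in\mathrm{Dom}(f)\times\mathbb R: y<f(x)\}$. The subsets $D_k^{(n)}\subset\mathrm{Dom}(\Phi_n)\subset\mathbb R^n$, $0\le k\le n$, are defined inductively, with $\Gamma_k^{(n)}\subset\mathbb R^{n+1}$ denoting the graph of $\Phi_n|_{D_k^{(n)}}$. Convention for $n=0$: $D_0^{(0)}=\mathbb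 R^0$ is a point, $\Phi_0=-1$, so $\Gamma_0^{(0)}=\{-1\}\subset\mathbb R$. For $n=1$: $D_0^{(1)}=(-1,\infty)$, $D_1^{(1)}=(-\infty,-1)$. For $n\ge1$: $D_0^{(n+1)}=\mathrm{epi}(\Phi_n|_{D_0^{(n)}})$; $D_{n+1}^{(n+1)}=\mathrm{hypo}(\Phi_n|_{D_n^{(n)}})$; and for $1\le k\le n$, $D_k^{(n+1)}=\mathrm{hypo}(\Phi_n|_{D_{k-1}^{(n)}})\cup(\Gamma_{k-1}^{(n-1)}\times\mathbb R)\cup\mathrm{epi}(\Phi_n|_{D_k^{(n)}})$. *)

(* Defs.v *)
From mathcomp Require Import all_boot all_order all_algebra.
From mathcomp Require Import all_classical all_reals all_analysis.

Set Implicit Arguments.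
Unset Strict Implicit.
Unset Printing Implicit Defensive.

Import Order.TTheory GRing.Theory Num.Theory.
Import numFieldNormedType.Exports.

Local Open Scope classical_set_scope.
Local Open Scope ring_scope.

(* Vectors of R^n are row vectors; the coordinate mu_i of the text is
   [mu 0 (i - 1)], and a point of R^(n+1) is read as the pair
   [(vinit mu, vlast mu)] in R^n x R. *)
Definition vinit (R : realType) (n : nat) (mu : 'rV[R]_n.+1) : 'rV[R]_n :=
  \row_(i < n) mu 0 (widen_ord (leqnSn n) i).

Definition vlast (R : realType) (n : nat) (mu : 'rV[R]_n.+1) : R := mu 0 ord_max.

Fixpoint Q (R : realType) (n : nat) {struct n} : 'rV[R]_n -> R :=
  match n return 'rV[R]_n -> R with
  | 0%N => fun=> 1
  | p.+1 =>
    let Qp := @Q R p in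
    match p return ('rV[R]_p -> R) -> 'rV[R]_p.+1 -> R with
    | 0%N => fun _ mu => 1 + vlast mu
    | q.+1 => fun Qp mu =>
        (2 + vlast mu) * Qp (vinit mu) - @Q R q (vinit (vinit mu))
    end Qp
  end.

(* The recurrences as written in the mathematics, here and for [D] below. *)
Lemma Q_0 (R : realType) (mu : 'rV[R]_0) : Q mu = 1.
Proof. by []. Qed.

Lemma Q_1 (R : realType) (mu : 'rV[R]_1) : Q mu = 1 + vlast mu.
Proof. by []. Qed.

Lemma Q_rec (R : realType) (n : nat) (mu : 'rV[R]_n.+2) :
  Q mu = (2 + vlast mu) * Q (vinit mu) - Q (vinit (vinit mu)).
Proof. by []. Qed.

(* [Phi n] is meant on its domain [Q n != 0] only; the sets [D n k] below
   are contained in it. *)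
Definition Phi (R : realType) (n : nat) : 'rV[R]_n -> R :=
  match n return 'rV[R]_n -> R with
  | 0%N => fun=> - 1
  | p.+1 => fun mu => Q (vinit mu) / Q mu - 2
  end.

(* Strict epigraph, strict hypograph and graph of the restriction of f to A. *)
Definition epi (R : realType) (n : nat) (f : 'rV[R]_n -> R) (A : set 'rV[R]_n) :
    set 'rV[R]_n.+1 :=
  [set mu | A (vinit mu) /\ f (vinit mu) < vlast mu].

Definition hypo (R : realType) (n : nat) (f : 'rV[R]_n -> R) (A : set 'rV[R]_n) :
    set 'rV[R]_n.+1 :=
  [set mu | A (vinit mu) /\ vlast mu < f (vinit mu)].

Definition graph (R : realType) (n : nat) (f : 'rV[R]_n -> R) (A : set 'rV[R]_n) :
    set 'rV[R]_n.+1 :=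
  [set mu | A (vinit mu) /\ vlast mu = f (vinit mu)].

Definition cylinder (R : realType) (n : nat) (A : set 'rV[R]_n) :
    set 'rV[R]_n.+1 :=
  [set mu | A (vinit mu)].

(* [D n k] is the set D_k^(n) when k <= n; it is empty (a junk value) when
   k > n. *)
Fixpoint D (R : realType) (n : nat) {struct n} : nat -> set 'rV[R]_n :=
  match n return nat -> set 'rV[R]_n with
  | 0%N => fun k => if k == 0%N then setT else set0
  | p.+1 =>
    let Dp := @D R p in
    match p return (nat -> set 'rV[R]_p) -> nat -> set 'rV[R]_p.+1 with
    | 0%N => fun _ k =>
        if k == 0%N then [set mu | - 1 < vlast mu]
        else if k == 1%N then [set mu | vlast mu < - 1]
        else set0
    | q.+1 => fun Dp k =>
        if k == 0%N then epi (@Phi R q.+1) (Dp 0%N)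
        else if (k <= q.+1)%N then
          hypo (@Phi R q.+1) (Dp k.-1)
          `|` cylinder (graph (@Phi R q) (@D R q k.-1))
          `|` epi (@Phi R q.+1) (Dp k)
        else if k == q.+2 then hypo (@Phi R q.+1) (Dp q.+1)
        else set0
    end Dp
  end.

Definition Gamma (R : realType) (n k : nat) : set 'rV[R]_n.+1 :=
  graph (@Phi R n) (@D R n k).

Lemma D_first (R : realType) (n : nat) :
  @D R n.+2 0 = epi (@Phi R n.+1) (@D R n.+1 0).
Proof. by []. Qed.

Lemma D_last (R : realType) (n : nat) :
  @D R n.+2 n.+2 = hypo (@Phi R n.+1) (@D R n.+1 n.+1).
Proof. by rewrite /= ltnn eqxx. Qed.

Lemma D_mid (R : realType) (n k : nat) : (1 <= k <= n.+1)%N ->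
  @D R n.+2 k = hypo (@Phi R n.+1) (@D R n.+1 k.-1)
                `|` cylinder (@Gamma R n k.-1)
                `|` epi (@Phi R n.+1) (@D R n.+1 k).
Proof. by case: k => // k /andP[_ kn]; rewrite [LHS]/= kn. Qed.

Definition partial (R : realType) (n : nat) (i : 'I_n) (f : 'rV[R]_n -> R) :
    'rV[R]_n -> R :=
  fun x => 'D_(delta_mx 0 i) f x.

(* f is of class C^r on U; only used for open U, where the partial
   derivatives at points of U depend on the restriction of f to U only. *)
Fixpoint Cr_on (R : realType) (n : nat) (r : nat) (U : set 'rV[R]_n)
    (f : 'rV[R]_n -> R) : Prop :=
  (forall x, U x -> {for x, continuous f}) /\
  match r with
  | 0%N => True
  | s.+1 => forall i : 'I_n,
      (forall x, U x -> derivable f x (delta_mx 0 i)) /\ Cr_on s U (partial i f)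
  end.

Definition smooth_map (R : realType) (n m : nat) (U : set 'rV[R]_n)
    (phi : 'rV[R]_n -> 'rV[R]_m) : Prop :=
  forall (j : 'I_m) (r : nat), Cr_on r U (fun x => phi x 0 j).

Definition diffeomorphism (R : realType) (n : nat) (U V : set 'rV[R]_n)
    (phi : 'rV[R]_n -> 'rV[R]_n) : Prop :=
  [/\ open U, open V, set_bij U V phi, smooth_map U phi &
      exists psi : 'rV[R]_n -> 'rV[R]_n,
        smooth_map V psi /\ (forall x, U x -> psi (phi x) = x)].

(* Embedded m-dimensional smooth submanifold of R^n, by slice charts: locally
   S is straightened to the coordinate subspace R^m x {0}. *)
Definition smooth_submanifold (R : realType) (n m : nat) (S : set 'rV[R]_n) :
    Prop :=
  (m <= n)%N /\
  forall p, S p -> exists U V (phi : 'rV[R]_n -> 'rV[R]_n),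
    [/\ U p, diffeomorphism U V phi &
        phi @` (S `&` U) =
        V `&` [set y | forall i : 'I_n, (m <= i)%N -> y 0 i = 0]].

Definition smooth_surface (R : realType) (n m : nat) (S : set 'rV[R]_n) : Prop :=
  [/\ S !=set0, connected S & smooth_submanifold m S].

(* C is a connected component of A. *)
Definition is_component (R : realType) (n : nat) (A C : set 'rV[R]_n) : Prop :=
  exists2 x, A x & C = connected_component A x.

(* Main.v *)
(* [D n k] consists of the points at which Q_n does not vanish and the sequence
   Q_0, ..., Q_n (zeros skipped) has exactly k sign changes: the sign of
   Q_n * Q_(n+1) tells on which side of the graph of Phi_n a point lies, and two
   consecutive Q's never vanish together.  This gives the two partitions.
   A zero Q_(n+1) sits between Q_n and Q_(n+2) of opposite signs, so a small
   perturbation of it does not change the number of sign changes; hence [D n k]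
   is open.  It is connected because the hypograph, cylinder and epigraph forming
   it are connected and are all met by a single line on which Q_(n+2) = - Q_n.
   A finite open partition into connected sets is the partition into components.
   Finally Phi_n is rational with nonvanishing denominator on the open set
   [D n k], so a shear along the last coordinate straightens its graph. *)
Require Import Defs.
From mathcomp Require Import all_boot all_order all_algebra.
From mathcomp Require Import all_classical all_reals all_analysis.
From mathcomp Require Import ring lra.

Set Implicit Arguments.
Unset Strict Implicit.
Unset Printing Implicit Defensive.

Import Order.TTheory GRing.Theory Num.Theory.
Import numFieldNormedType.Exports.

Local Open Scope classical_set_scope.
Local Open Scope ring_scope.

(** * Smooth functions *)

Lemma near_eq_continuous (T S : topologicalType) (f g : T -> S) (x : T) :
  (\forall y \near x, f y = g y) -> {for x, continuous f} ->
  {for x, continuous g}.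
Proof.
rewrite /prop_for /continuous_at => fg fx; rewrite -(nbhs_singleton fg).
by apply: cvg_trans fx; exact: near_eq_cvg.
Qed.

Section Smooth.
Variables (R : realType) (m : nat).
Implicit Types (U : set 'rV[R]_m) (f g : 'rV[R]_m -> R).

Definition smooth U f := forall r, Cr_on r U f.

(** On an open [U], agreement on [U] is agreement near each point, hence passes to all partial
    derivatives. This lets the differentiation rules below, valid on [U] only, replace [partial i]
    of a sum, product or inverse. *)
Lemma eq_Cr_on r U f g : open U -> (forall x, U x -> f x = g x) ->
  Cr_on r U f -> Cr_on r U g.
Proof.
move=> oU; elim: r f g => [|r IH] f g fg [cf df]; have nfg x : U x ->
    \forall y \near x, f y = g y by
  move=> Ux; have := open_nbhs_nbhs (conj oU Ux); apply: filterS => y /fg.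
all: have cg x : U x -> {for x, continuous g} by
  move=> Ux; exact: near_eq_continuous (nfg _ Ux) (cf _ Ux).
- by split.
- split=> // i.
  have [dfi pfi] := df i; split=> [x Ux|].
    exact: near_eq_derivable (nfg _ Ux) (dfi _ Ux).
  by apply: IH pfi => x Ux; exact/near_eq_derive/nfg.
Qed.

Lemma Cr_onW r U f : Cr_on r.+1 U f -> Cr_on r U f.
Proof.
elim: r f => [|r IH] f [cf df]; split=> // i.
by have [dfi pfi] := df i; split=> //; exact: IH.
Qed.

Lemma Cr_on_continuous r U f x : Cr_on r U f -> U x -> {for x, continuous f}.
Proof. by case: r => [|r] [cf _]; exact: cf. Qed.

Lemma Cr_on_cst r U c : Cr_on r U (fun=> c).
Proof.
have cc k x : {for x, continuous ((fun=> k) : 'rV[R]_m -> R)}.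
  exact: cst_continuous.
elim: r c => [|r IH] c; first by split.
split=> // i; split=> [x _|]; first exact: derivable_cst.
rewrite (_ : partial i _ = fun=> 0) //.
by apply/funext => x; rewrite /partial derive_cst.
Qed.

Lemma Cr_on_coord r U j : Cr_on r U (fun x : 'rV[R]_m => x 0 j).
Proof.
have cc x : {for x, continuous (fun x : 'rV[R]_m => x 0 j)}.
  exact: coord_continuous.
case: r => [|r]; first by split.
split=> // i; split=> [x _|]; first exact/diff_derivable/differentiable_coord.
rewrite (_ : partial i _ = fun=> (delta_mx 0 i : 'rV[R]_m) 0 j).
  exact: Cr_on_cst.
apply/funext => x; rewrite /partial; apply: cvg_lim => //.
(* The difference quotient equals this constant for every [h != 0], so both have the same limit
   along the punctured neighbourhoods of 0. *)
apply: cvg_trans (cvg_cst (F := (0 : R)^') ((delta_mx 0 i : 'rV[R]_m) 0 j)).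
apply: near_eq_cvg.
have := nbhs_dnbhs_neq (0 : R); apply: filterS => h h0.
by rewrite /= !mxE addrK /GRing.scale /= mulKf.
Qed.

Lemma Cr_onD r U f g : open U -> Cr_on r U f -> Cr_on r U g ->
  Cr_on r U (fun x => f x + g x).
Proof.
move=> oU; elim: r f g => [|r IH] f g [cf df] [cg dg].
  by split=> // x Ux; exact: continuousD (cf _ Ux) (cg _ Ux).
split=> [x Ux|i]; first exact: continuousD (cf _ Ux) (cg _ Ux).
have [dfi pfi] := df i; have [dgi pgi] := dg i; split=> [x Ux|].
  exact: derivableD (dfi _ Ux) (dgi _ Ux).
apply: (eq_Cr_on oU _ (IH _ _ pfi pgi)) => x Ux.
by rewrite /partial -(deriveD (dfi _ Ux) (dgi _ Ux)).
Qed.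

Lemma Cr_onM r U f g : open U -> Cr_on r U f -> Cr_on r U g ->
  Cr_on r U (fun x => f x * g x).
Proof.
move=> oU; elim: r f g => [|r IH] f g Cf Cg; have [cf df] := Cf; have [cg dg] := Cg.
  by split=> // x Ux; exact: continuousM (cf _ Ux) (cg _ Ux).
split=> [x Ux|i]; first exact: continuousM (cf _ Ux) (cg _ Ux).
have [dfi pfi] := df i; have [dgi pgi] := dg i; split=> [x Ux|].
  exact: derivableM (dfi _ Ux) (dgi _ Ux).
apply: (eq_Cr_on oU _ (Cr_onD oU (IH _ _ (Cr_onW Cf) pgi)
                                 (IH _ _ (Cr_onW Cg) pfi))) => x Ux.
by rewrite /partial [RHS](deriveM (dfi _ Ux) (dgi _ Ux)).
Qed.

(** Induction on [r] with [f] fixed: the partial derivative of [1/f] is [-(1/f)(1/f)] times that of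
    [f], a product of functions already known to be of class one lower. *)
Lemma Cr_onV r U f : open U -> (forall x, U x -> f x != 0) ->
  Cr_on r U f -> Cr_on r U (fun x => (f x)^-1).
Proof.
move=> oU f0; elim: r => [|r IH] Cf.
  by case: Cf => cf _; split=> // x Ux; exact: continuousV (f0 _ Ux) (cf _ Ux).
have [cf df] := Cf.
split=> [x Ux|i]; first exact: continuousV (f0 _ Ux) (cf _ Ux).
have [dfi pfi] := df i; split=> [x Ux|].
  exact: derivableV (f0 _ Ux) (dfi _ Ux).
have CV := IH (Cr_onW Cf).
apply: (eq_Cr_on oU _ (Cr_onM oU (Cr_on_cst r U (-1))
  (Cr_onM oU (Cr_onM oU CV CV) pfi))) => x Ux.
rewrite /partial [RHS](deriveV (f0 _ Ux) (dfi _ Ux)).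
by rewrite /GRing.scale /= -exprVn expr2; ring.
Qed.

Lemma smooth_cst U c : smooth U (fun=> c).
Proof. by move=> r; exact: Cr_on_cst. Qed.

Lemma smooth_coord U j : smooth U (fun x : 'rV[R]_m => x 0 j).
Proof. by move=> r; exact: Cr_on_coord. Qed.

Lemma smoothD U f g : open U -> smooth U f -> smooth U g ->
  smooth U (fun x => f x + g x).
Proof. by move=> oU sf sg r; exact: Cr_onD. Qed.

Lemma smoothM U f g : open U -> smooth U f -> smooth U g ->
  smooth U (fun x => f x * g x).
Proof. by move=> oU sf sg r; exact: Cr_onM. Qed.

Lemma smoothB U f g : open U -> smooth U f -> smooth U g ->
  smooth U (fun x => f x - g x).
Proof.
move=> oU sf sg; apply: smoothD => // r.
apply: (eq_Cr_on oU _ (smoothM oU (smooth_cst U (-1)) sg r)) => x _.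
by rewrite mulN1r.
Qed.

Lemma smooth_div U f g : open U -> (forall x, U x -> g x != 0) ->
  smooth U f -> smooth U g -> smooth U (fun x => f x / g x).
Proof. by move=> oU g0 sf sg; apply: smoothM => // r; exact: Cr_onV. Qed.

Lemma smooth_vinit n (phi : 'rV[R]_m -> 'rV[R]_n.+1) U :
  (forall j, smooth U (fun x => phi x 0 j)) ->
  forall j, smooth U (fun x => vinit (phi x) 0 j).
Proof.
move=> sphi j; rewrite (_ : (fun x => _) =
  (fun x => phi x 0 (widen_ord (leqnSn _) j))) //.
by apply/funext => x; rewrite mxE.
Qed.

(** Composing with an arbitrary [phi] keeps the source space and [U] fixed while the induction on
    [n] replaces [phi] by its truncations. *)
Lemma smooth_Q n (phi : 'rV[R]_m -> 'rV[R]_n) U : open U ->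
  (forall j, smooth U (fun x => phi x 0 j)) -> smooth U (fun x => Q (phi x)).
Proof.
move=> oU; elim/ltn_ind: n phi => -[|[|n]] IH phi sphi.
- exact: smooth_cst.
- apply: smoothD => //; [exact: smooth_cst|exact: sphi].
- have s1 := smooth_vinit sphi; have s2 := smooth_vinit s1.
  rewrite (_ : (fun x => _) = (fun x => (2 + vlast (phi x)) * Q (vinit (phi x))
    - Q (vinit (vinit (phi x))))) //.
  apply: smoothB => //; last exact: (IH n _ (fun x => vinit (vinit (phi x)))).
  apply: smoothM => //; last exact: (IH n.+1 _ (fun x => vinit (phi x))).
  apply: smoothD => //; [exact: smooth_cst|exact: sphi].
Qed.

Lemma smooth_Phi n (phi : 'rV[R]_m -> 'rV[R]_n) U : open U ->
  (forall x, U x -> Q (phi x) != 0) ->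
  (forall j, smooth U (fun x => phi x 0 j)) -> smooth U (fun x => Phi (phi x)).
Proof.
case: n phi => [|n] phi oU Q0 sphi; first exact: smooth_cst.
apply: smoothB => //; last exact: smooth_cst.
apply: smooth_div => //; last exact: smooth_Q.
by apply: (smooth_Q (phi := fun x => vinit (phi x))) => //; exact: smooth_vinit.
Qed.

End Smooth.

(** * Row vectors: coordinatewise convergence and appending a coordinate *)

Section Rows.
Variable R : realType.

Lemma cvg_rV (T : Type) (F : set_system T) {FF : Filter F} n
    (f : T -> 'rV[R]_n) (l : 'rV[R]_n) :
  (forall j, (fun x => f x 0 j) @ F --> l 0 j) -> f @ F --> l.
Proof.
move=> fl A [P lP PA].
have : \forall x \near F, forall j, P 0 j (f x 0 j).
  by apply: filter_forall => j; exact: fl (lP 0 j).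
by apply: filterS => x Px; apply: PA => i j; rewrite ord1.
Qed.

(** Inverse of [mu |-> (vinit mu, vlast mu)]: [insub] fails exactly at the last index, where the
    default [y] is taken. *)
Definition vsnoc n (x : 'rV[R]_n) (y : R) : 'rV[R]_n.+1 :=
  \row_(i < n.+1) oapp (x 0) y (insub (i : nat)).

Lemma vsnocK n (x : 'rV[R]_n) y : vinit (vsnoc x y) = x.
Proof. by apply/rowP => j; rewrite !mxE /= (valK j). Qed.

Lemma vlast_vsnoc n (x : 'rV[R]_n) y : vlast (vsnoc x y) = y.
Proof. by rewrite /vlast mxE insubF //= ltnn. Qed.

Lemma vsnoc_vinit n (mu : 'rV[R]_n.+1) : vsnoc (vinit mu) (vlast mu) = mu.
Proof.
apply/rowP => j; rewrite mxE; case: insubP => [i _ ij|] /=.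
  by rewrite mxE; congr (mu _ _); exact/val_inj.
rewrite -leqNgt => nj; congr (mu _ _); apply/val_inj => /=.
by apply/eqP; rewrite eqn_leq nj -ltnS ltn_ord.
Qed.

Lemma vinit_continuous n : continuous (@vinit R n).
Proof.
move=> mu; apply: (@cvg_rV _ (nbhs mu) _) => j; rewrite mxE.
under eq_fun do rewrite mxE.
exact: coord_continuous.
Qed.

Lemma vlast_continuous n : continuous (@vlast R n).
Proof. by move=> mu; exact: coord_continuous. Qed.

Lemma cvg_vsnoc (T : Type) (F : set_system T) {FF : Filter F} n
    (f : T -> 'rV[R]_n) (g : T -> R) x y :
  f @ F --> x -> g @ F --> y -> (fun t => vsnoc (f t) (g t)) @ F --> vsnoc x y.
Proof.
move=> fx gy; apply: cvg_rV => j; rewrite mxE.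
under eq_fun do rewrite mxE.
case: insub => [i|] //=.
exact: (cvg_comp f (fun M : 'rV[R]_n => M 0 i) fx (@coord_continuous _ _ _ 0 i x)).
Qed.

Lemma Q_continuous n : continuous (@Q R n).
Proof.
move=> x; apply: (@Cr_on_continuous _ _ 0 setT) => //.
by apply: (smooth_Q (phi := id)) => // [|j]; [exact: openT|exact: smooth_coord].
Qed.

Lemma Phi_continuous n (x : 'rV[R]_n) : Q x != 0 -> {for x, continuous (@Phi R n)}.
Proof.
move=> Qx; apply: (@Cr_on_continuous _ _ 0 [set x | Q x != 0]) => //.
apply: (smooth_Phi (phi := id)) => // [|j]; last exact: smooth_coord.
have := @open_comp _ _ (@Q R n) [set y | y != 0]; apply.
  by move=> ? _; exact: Q_continuous.
exact: open_neq.
Qed.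

End Rows.

(** * Sign changes *)

Section Strata.
Variable R : realType.

(** As a function of the last coordinate, [Q mu] is affine with slope [Q (vinit mu)], and
    [Phi (vinit mu)] is its root; the convention [Phi = -1] in dimension 0 makes this hold there
    too. *)
Lemma Q_Phi n (mu : 'rV[R]_n.+1) : Q (vinit mu) != 0 ->
  Q mu = Q (vinit mu) * (vlast mu - Phi (vinit mu)).
Proof.
case: n mu => [|n] mu Q0.
  by rewrite Q_0 Q_1 /= mul1r opprK addrC.
by rewrite Q_rec /= mulrBr mulrBr mulrCA divff //; ring.
Qed.

Lemma Q_two_step n (mu : 'rV[R]_n.+2) : Q (vinit mu) = 0 ->
  Q mu = - Q (vinit (vinit mu)).
Proof. by rewrite Q_rec => ->; rewrite mulr0 sub0r. Qed.

(** Two consecutive zeros would propagate down the recurrence to the constant 1. *)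
Lemma Q_consecutive n (mu : 'rV[R]_n.+1) : Q mu = 0 -> Q (vinit mu) != 0.
Proof.
elim: n mu => [|n IH] mu; first by rewrite oner_neq0.
move=> Q0; apply/eqP => Q1; move: Q0; rewrite Q_two_step // => /eqP.
by rewrite oppr_eq0; apply/negP; exact: IH.
Qed.

Lemma Q_mul_gt0 n (mu : 'rV[R]_n.+1) : Q (vinit mu) != 0 ->
  (0 < Q (vinit mu) * Q mu) = (Phi (vinit mu) < vlast mu).
Proof.
move=> Q0; rewrite (Q_Phi Q0) mulrA -expr2 pmulr_rgt0 ?subr_gt0 //.
by rewrite exprn_even_gt0.
Qed.

Lemma Q_mul_lt0 n (mu : 'rV[R]_n.+1) : Q (vinit mu) != 0 ->
  (Q (vinit mu) * Q mu < 0) = (vlast mu < Phi (vinit mu)).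
Proof.
move=> Q0; rewrite (Q_Phi Q0) mulrA -expr2 pmulr_rlt0 ?subr_lt0 //.
by rewrite exprn_even_gt0.
Qed.

Lemma Q_eq0 n (mu : 'rV[R]_n.+1) : Q (vinit mu) != 0 ->
  (Q mu == 0) = (vlast mu == Phi (vinit mu)).
Proof. by move=> Q0; rewrite (Q_Phi Q0) mulf_eq0 (negbTE Q0) subr_eq0. Qed.

(** * The recursion for the strata, uniform in the index *)

Lemma D_out n k : (n < k)%N -> @D R n k = set0.
Proof.
case: n => [|[|n]]; case: k => [|[|k]] // nk; rewrite /=.
by rewrite leqNgt ltnW //= gtn_eqF.
Qed.

Lemma epi_set0 n (f : 'rV[R]_n -> R) : epi f set0 = set0.
Proof. by apply/seteqP; split=> mu // []. Qed.

Lemma hypo_set0 n (f : 'rV[R]_n -> R) : hypo f set0 = set0.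
Proof. by apply/seteqP; split=> mu // []. Qed.

Lemma Gamma_set0 n k : (n < k)%N -> @Gamma R n k = set0.
Proof. by move=> nk; rewrite /Gamma D_out //; apply/seteqP; split=> mu // []. Qed.

Lemma D_1_0 : @D R 1 0 = epi (@Phi R 0) (@D R 0 0).
Proof. by apply/seteqP; split=> mu //= []. Qed.

Lemma D_1_S k : @D R 1 k.+1 = hypo (@Phi R 0) (@D R 0 k).
Proof.
case: k => [|k]; first by apply/seteqP; split=> mu //= [].
by rewrite [@D R 0 _]D_out // hypo_set0.
Qed.

(** Out-of-range strata are empty, so the formula for middle indices also covers the last index and
    all larger ones. Later case analyses then only separate [0] from [k.+1]. *)
Lemma D_SS_S n k : @D R n.+2 k.+1 =
  hypo (@Phi R n.+1) (@D R n.+1 k) `|` cylinder (@Gamma R n k)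
  `|` epi (@Phi R n.+1) (@D R n.+1 k.+1).
Proof.
case: (ltngtP k n.+1) => [kn|nk|->]; first by rewrite D_mid.
  rewrite !D_out ?ltnS // 1?ltnW // Gamma_set0 1?ltnW // hypo_set0 epi_set0.
  by rewrite setU0 set0U; apply/seteqP; split.
rewrite D_last Gamma_set0 // [@D R n.+1 n.+2]D_out // epi_set0 setU0.
by rewrite [cylinder _](_ : _ = set0) ?setU0 //; apply/seteqP; split.
Qed.

Lemma epi_sub_D n k : epi (@Phi R n) (@D R n k) `<=` @D R n.+1 k.
Proof.
case: n k => [|n] [|k]; rewrite ?D_1_0 ?D_1_S ?D_first ?D_SS_S //.
by rewrite D_out // epi_set0.
Qed.

Lemma hypo_sub_D n k : hypo (@Phi R n) (@D R n k) `<=` @D R n.+1 k.+1.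
Proof.
by case: n => [|n]; rewrite ?D_1_S ?D_SS_S // => mu; left; left.
Qed.

(** Off the graph of [Phi] the affine factorization is nonzero; over the graph the middle term
    vanishes, so [Q mu] is minus the value two levels down, nonzero by induction. *)
Lemma D_Q_neq0 n k (mu : 'rV[R]_n) : D k mu -> Q mu != 0.
Proof.
elim/ltn_ind: n k mu => -[|[|n]] IH k mu; first by rewrite oner_neq0.
  have Q0 : Q (vinit mu) != 0 by rewrite oner_neq0.
  rewrite (Q_eq0 Q0); case: k => [|k]; rewrite ?D_1_0 ?D_1_S => -[_].
    by move/gt_eqF => ->.
  by move/lt_eqF => ->.
have E j : D j (vinit mu) -> (Phi (vinit mu) < vlast mu) || (vlast mu < Phi (vinit mu))
    -> Q mu != 0.
  move=> /(IH _ (ltnSn _)) Q0; rewrite (Q_eq0 Q0).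
  by rewrite eq_sym neq_lt.
case: k => [|k]; first by rewrite D_first => -[/E h lt]; rewrite h ?lt.
rewrite D_SS_S => -[[[/E h lt]|[Dv /eqP]]|[/E h lt]]; try by rewrite h ?lt ?orbT.
have Q1 := IH _ (ltnW (ltnSn _)) _ _ Dv.
by rewrite -Q_eq0 // => /eqP Q0; rewrite Q_two_step // oppr_eq0.
Qed.

Lemma Gamma_Q_eq0 n k (mu : 'rV[R]_n.+1) : Gamma k mu -> Q mu = 0.
Proof. by case=> Dv /eqP; rewrite -Q_eq0 ?(D_Q_neq0 Dv) // => /eqP. Qed.

(** If [Q (vinit mu)] is nonzero, the side of the graph of [Phi] places [mu]; otherwise the value
    two levels down is nonzero and [mu] lies in a cylinder. *)
Lemma D_cover n (mu : 'rV[R]_n) : Q mu != 0 ->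
  exists2 k, (k < n.+1)%N & D k mu.
Proof.
suff: Q mu != 0 -> exists k, D k mu.
  move=> H /H[k Dk]; exists k => //; rewrite ltnS leqNgt; apply/negP => nk.
  by move: Dk; rewrite D_out.
elim/ltn_ind: n mu => -[|n] IH mu Q0; first by exists 0%N.
have [Qv|Qv] := eqVneq (Q (vinit mu)) 0.
  case: n => [|n] in IH mu Q0 Qv *.
    by move/eqP: Qv; rewrite oner_eq0.
  have /IH[//|k Dk] := Q_consecutive Qv.
  exists k.+1; rewrite D_SS_S; left; right; split=> //.
  by apply/eqP; rewrite -Q_eq0 ?Qv ?eqxx //; exact: Q_consecutive.
have [k Dk] := IH _ (ltnSn _) _ Qv.
move: Q0; rewrite (Q_eq0 Qv) neq_lt => /orP[h|h].
  by exists k.+1; apply: hypo_sub_D.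
by exists k; apply: epi_sub_D.
Qed.

(** The sign of [vlast mu - Phi (vinit mu)] separates hypograph from epigraph, the vanishing of
    [Q (vinit mu)] singles out the cylinder, and within one branch induction fixes the index. *)
Lemma D_inj n k l (mu : 'rV[R]_n) : D k mu -> D l mu -> k = l.
Proof.
elim/ltn_ind: n k l mu => -[|[|n]] IH k l mu.
- by case: k l => [|k] [|l].
- have D0 j : D j (vinit mu) -> j = 0%N by case: j.
  case: k l => [|k] [|l]; rewrite ?D_1_0 ?D_1_S => -[/D0 + h1] [/D0 + h2] //.
  + by rewrite ltNge (ltW h1) in h2.
  + by rewrite ltNge (ltW h2) in h1.
  + by move=> -> ->.
- wlog kl : k l / (k <= l)%N.
    move=> W Dk Dl; case/orP: (leq_total k l) => kl; first exact: (W k l).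
    by apply/esym; exact: (W l k).
  have I1 a b : D a (vinit mu) -> D b (vinit mu) -> a = b by apply: IH.
  have I2 a b : D a (vinit (vinit mu)) -> D b (vinit (vinit mu)) -> a = b.
    by apply: IH.
  have GD a b : cylinder (@Gamma R n a) mu -> D b (vinit mu) -> False.
    by move=> /Gamma_Q_eq0 Q0 /D_Q_neq0; rewrite Q0 eqxx.
  have asym : Phi (vinit mu) < vlast mu -> vlast mu < Phi (vinit mu) -> False.
    by move=> h1; rewrite ltNge (ltW h1).
  case: k l kl => [|k] [|l] // kl; rewrite ?D_first ?D_SS_S.
    move=> [Dk hk] [[[Dl hl]|G]|[Dl hl]]; [by case: asym|by case: (GD _ _ G Dk)|].
    exact: I1 Dk Dl.
  move=> [[[Dk hk]|Gk]|[Dk hk]] [[[Dl hl]|Gl]|[Dl hl]].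
  + by rewrite (I1 _ _ Dk Dl).
  + by case: (GD _ _ Gl Dk).
  + by case: asym.
  + by case: (GD _ _ Gk Dl).
  + by case: Gk Gl => [Dk _] [Dl _]; rewrite (I2 _ _ Dk Dl).
  + by case: (GD _ _ Gk Dl).
  + by case: asym.
  + by case: (GD _ _ Gl Dk).
  + exact: I1 Dk Dl.
Qed.

(* Whatever the sign of the middle term, the triple Q_n, Q_(n+1), Q_(n+2) has
   exactly one sign change when its outer terms have opposite signs. *)
Lemma bridge_sub_D n k (mu : 'rV[R]_n.+2) : D k (vinit (vinit mu)) ->
  Q (vinit (vinit mu)) * Q mu < 0 -> D k.+1 mu.
Proof.
move=> Dk Qneg; have Q0 := D_Q_neq0 Dk.
have [Q1|Q1] := eqVneq (Q (vinit mu)) 0.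
  rewrite D_SS_S; left; right; split=> //.
  by apply/eqP; rewrite -Q_eq0 // Q1.
have := mulf_neq0 Q0 Q1; rewrite neq_lt => /orP[h|h].
- apply: epi_sub_D; split; first by apply: hypo_sub_D; split=> //; rewrite -Q_mul_lt0.
  by rewrite -Q_mul_gt0 //; nra.
- apply: hypo_sub_D; split; first by apply: epi_sub_D; split=> //; rewrite -Q_mul_gt0.
  by rewrite -Q_mul_lt0 //; nra.
Qed.

(** The cylinder over a graph is not visibly inside the interior; enlarging it to a set cut out by a
    strict inequality, still inside the stratum, writes the stratum as a union of open sets. *)
Lemma D_SS_S_bridge n k : @D R n.+2 k.+1 =
  hypo (@Phi R n.+1) (@D R n.+1 k)
  `|` [set mu | D k (vinit (vinit mu)) /\ Q (vinit (vinit mu)) * Q mu < 0]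
  `|` epi (@Phi R n.+1) (@D R n.+1 k.+1).
Proof.
apply/seteqP; split=> mu.
  rewrite D_SS_S => -[[?|G]|?]; [by left; left| |by right].
  left; right; split; first by case: G.
  rewrite Q_two_step ?(Gamma_Q_eq0 G) // mulrN oppr_lt0 -expr2.
  by rewrite exprn_even_gt0 //=; case: G => /D_Q_neq0.
move=> [[/hypo_sub_D//|[h1 h2]]|/epi_sub_D//]; exact: bridge_sub_D.
Qed.

End Strata.

(** * Topology of the strata *)

Lemma connected_component_clopen (T : topologicalType) (C C' : set T) (x : T) :
  open C -> open C' -> C `&` C' = set0 -> connected C -> C x ->
  connected_component (C `|` C') x = C.
Proof.
move=> oC oC' CC' cC Cx; apply/seteqP; split=> [y [B [Bx BA cB] By]|]; last first.
  exact: connected_component_max.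
suff: B `&` C = B by move=> BC; have [] : (B `&` C) y by rewrite BC.
apply: cB; [by exists x|by exists C|exists (~` C'); first exact: open_closedC].
apply/seteqP; split=> z [Bz Hz]; split=> //.
  by move=> C'z; have : set0 z by rewrite -CC'.
by case: (BA _ Bz).
Qed.

Section Topology.
Variable R : realType.

(** * Openness of the strata *)

Lemma open_cylinder n (A : set 'rV[R]_n) : open A -> open (cylinder A).
Proof.
have /continuousP := @vinit_continuous R n; exact.
Qed.

Lemma continuous_vinit n (f : 'rV[R]_n -> R) (mu : 'rV[R]_n.+1) :
  {for vinit mu, continuous f} -> {for mu, continuous (f \o @vinit R n)}.
Proof. by apply: continuous_comp; exact: vinit_continuous. Qed.

(** Conditions on the vertical offset from the graph put epigraphs and hypographs in one form,
    handled by [open_shear] and [connected_shear]. *)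
Lemma epiE n (f : 'rV[R]_n -> R) (A : set 'rV[R]_n) :
  epi f A =
  [set mu | A (vinit mu) /\ [set t | 0 < t] (vlast mu - f (vinit mu))].
Proof. by apply/seteqP; split=> mu; rewrite /= subr_gt0. Qed.

Lemma hypoE n (f : 'rV[R]_n -> R) (A : set 'rV[R]_n) :
  hypo f A =
  [set mu | A (vinit mu) /\ [set t | t < 0] (vlast mu - f (vinit mu))].
Proof. by apply/seteqP; split=> mu; rewrite /= subr_lt0. Qed.

Lemma open_shear n (A : set 'rV[R]_n) (f : 'rV[R]_n -> R) (I : set R) :
  open A -> open I -> (forall x, A x -> {for x, continuous f}) ->
  open [set mu | A (vinit mu) /\ I (vlast mu - f (vinit mu))].
Proof.
move=> oA oI cf; rewrite openE => mu [Amu Imu].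
have nA := open_nbhs_nbhs (conj (open_cylinder oA) Amu).
have cg : {for mu, continuous (fun nu => vlast nu - (f \o @vinit R n) nu)}.
  by apply: continuousB; [exact: vlast_continuous|exact/continuous_vinit/cf].
have /cg nI := open_nbhs_nbhs (conj oI Imu).
by rewrite /interior; apply: filterS2 nA nI.
Qed.

Lemma open_epi n (f : 'rV[R]_n -> R) (A : set 'rV[R]_n) : open A ->
  (forall x, A x -> {for x, continuous f}) -> open (epi f A).
Proof. by move=> oA cf; rewrite epiE; apply: open_shear => //; exact: open_gt. Qed.

Lemma open_hypo n (f : 'rV[R]_n -> R) (A : set 'rV[R]_n) : open A ->
  (forall x, A x -> {for x, continuous f}) -> open (hypo f A).
Proof. by move=> oA cf; rewrite hypoE; apply: open_shear => //; exact: open_lt. Qed.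

Lemma D_Phi_continuous n k (x : 'rV[R]_n) : D k x ->
  {for x, continuous (@Phi R n)}.
Proof. by move=> /D_Q_neq0; exact: Phi_continuous. Qed.

Lemma open_D n k : open (@D R n k).
Proof.
elim/ltn_ind: n k => -[|[|n]] IH k.
- by case: k => [|k] /=; [exact: openT|exact: open0].
- case: k => [|k]; rewrite ?D_1_0 ?D_1_S; [apply: open_epi|apply: open_hypo];
  by [apply: IH|exact: D_Phi_continuous].
- case: k => [|k]; rewrite ?D_first ?D_SS_S_bridge.
    by apply: open_epi; [apply: IH|exact: D_Phi_continuous].
  apply: openU; last by apply: open_epi; [apply: IH|exact: D_Phi_continuous].
  apply: openU; first by apply: open_hypo; [apply: IH|exact: D_Phi_continuous].
  apply: (@openI _ (cylinder (cylinder (@D R n k))));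
    first by do 2![apply: open_cylinder]; apply: IH.
  pose g := (@Q R n \o @vinit R n) \o @vinit R n.+1.
  have : continuous (fun mu => g mu * @Q R n.+2 mu).
    move=> mu; apply: continuousM; last exact: Q_continuous.
    by apply: continuous_vinit; apply: continuous_vinit; exact: Q_continuous.
  by move=> /continuousP/(_ _ (@open_lt R 0)).
Qed.

(** * Connectedness of the strata and of the graphs *)

Lemma connected_shear n (A : set 'rV[R]_n) (f : 'rV[R]_n -> R) (I : set R) :
  connected A -> is_interval I -> (forall x, A x -> {for x, continuous f}) ->
  connected [set mu | A (vinit mu) /\ I (vlast mu - f (vinit mu))].
Proof.
move=> cA /connected_intervalP cI cf.
have [->|/set0P[x0 Ax0]] := eqVneq A set0.
  rewrite [X in connected X](_ : _ = set0); first exact: connected0.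
  by apply/seteqP; split=> mu // [].
have [->|/set0P[t0 It0]] := eqVneq I set0.
  rewrite [X in connected X](_ : _ = set0); first exact: connected0.
  by apply/seteqP; split=> mu // [].
(* The region is swept out by vertical translates of the graph, all joined by one vertical fiber
   over [x0]. *)
pose leaf t := (fun x => vsnoc x (f x + t)) @` A.
pose fiber := (fun t => vsnoc x0 (f x0 + t)) @` I.
rewrite [X in connected X](_ : _ = \bigcup_(t in I) (leaf t `|` fiber)).
  apply: bigcup_connected.
    by exists (vsnoc x0 (f x0 + t0)) => t It; right; exists t0.
  move=> t It; apply: connectedU.
  - by exists (vsnoc x0 (f x0 + t)); split; [exists x0|exists t].
  - apply: connected_continuous_connected => //.
    apply: continuous_in_subspaceT => x /[!inE] Ax.
    apply: (@cvg_vsnoc _ _ (nbhs x) _ _ id (fun x => f x + t)); first exact: cvg_id.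
    by apply: continuousD; [exact: cf|exact: cst_continuous].
  - apply: connected_continuous_connected => //.
    apply: continuous_subspaceT => s.
    apply: (@cvg_vsnoc _ _ (nbhs s) _ _ (fun=> x0) (fun s => f x0 + s)).
      exact: cvg_cst.
    by apply: continuousD; [exact: cst_continuous|exact: cvg_id].
apply/seteqP; split=> mu.
  move=> [Amu Imu]; exists (vlast mu - f (vinit mu)) => //; left.
  by exists (vinit mu) => //; rewrite addrC subrK vsnoc_vinit.
move=> [t It [[x Ax <-]|[s Is <-]]] /=; rewrite vsnocK vlast_vsnoc addrC addKr //.
Qed.

Lemma connected_epi n (A : set 'rV[R]_n) (f : 'rV[R]_n -> R) : connected A ->
  (forall x, A x -> {for x, continuous f}) -> connected (epi f A).
Proof.
move=> cA cf; rewrite epiE; apply: connected_shear => // x y /= x0 _ z /andP[xz _].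
exact: lt_le_trans xz.
Qed.

Lemma connected_hypo n (A : set 'rV[R]_n) (f : 'rV[R]_n -> R) : connected A ->
  (forall x, A x -> {for x, continuous f}) -> connected (hypo f A).
Proof.
move=> cA cf; rewrite hypoE; apply: connected_shear => // x y /= _ y0 z /andP[_ zy].
exact: le_lt_trans y0.
Qed.

Lemma connected_graph n (A : set 'rV[R]_n) (f : 'rV[R]_n -> R) : connected A ->
  (forall x, A x -> {for x, continuous f}) -> connected (graph f A).
Proof.
move=> cA cf; rewrite (_ : graph f A =
  [set mu | A (vinit mu) /\ [set t | t = 0] (vlast mu - f (vinit mu))]).
  apply: connected_shear => // x y /= -> -> z /andP[z0 z1].
  by apply/eqP; rewrite eq_le z0 z1.
apply/seteqP; split=> mu [Amu e]; split=> //=; first by rewrite e subrr.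
exact/subr0_eq.
Qed.

Lemma connected_cylinder n (A : set 'rV[R]_n) :
  connected A -> connected (cylinder A).
Proof.
move=> cA; rewrite (_ : cylinder A =
  [set mu | A (vinit mu) /\ setT (vlast mu - cst 0 (vinit mu))]).
  by apply: connected_shear => // x _; exact: cst_continuous.
by apply/seteqP; split=> mu //= [].
Qed.

(** One unit above the graph of [Phi] keeps the index; one unit below raises it by one. *)
Lemma D_nonempty n k : (k <= n)%N -> @D R n k !=set0.
Proof.
elim: n k => [|n IH] k kn; first by move: kn; rewrite leqn0 => /eqP ->; exists 0.
case: k kn => [|k] kn.
  have [x Dx] := IH 0%N isT; exists (vsnoc x (Phi x + 1)); apply: epi_sub_D.
  by split; rewrite ?vsnocK ?vlast_vsnoc ?ltrDl.
have [x Dx] := IH k kn; exists (vsnoc x (Phi x - 1)); apply: hypo_sub_D.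
by split; rewrite ?vsnocK ?vlast_vsnoc ?gtrDl ?ltrN10.
Qed.

Lemma connected_D n k : (k <= n)%N -> connected (@D R n k).
Proof.
elim/ltn_ind: n k => -[|[|n]] IH k kn.
- move: kn; rewrite leqn0 => /eqP ->.
  rewrite (_ : D 0 = [set 0]); first exact: connected1.
  by apply/seteqP; split=> x //= _; apply/rowP => -[].
- case: k kn => [|k] kn; rewrite ?D_1_0 ?D_1_S;
    [apply: connected_epi|apply: connected_hypo];
  by [apply: IH|exact: D_Phi_continuous].
- case: k kn => [|k] kn.
    by rewrite D_first; apply: connected_epi; [apply: IH|exact: D_Phi_continuous].
  have chypo : connected (hypo (@Phi R n.+1) (@D R n.+1 k)).
    by apply: connected_hypo; [apply: IH|exact: D_Phi_continuous].
  (* For the top index the stratum is a single hypograph. *)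
  move: kn; rewrite ltnS leq_eqVlt => /predU1P[kE|].
    by move: chypo; rewrite kE D_last.
  rewrite ltnS => kn.
  have cepi : connected (epi (@Phi R n.+1) (@D R n.+1 k.+1)).
    by apply: connected_epi; [apply: IH|exact: D_Phi_continuous].
  have ccyl : connected (cylinder (@Gamma R n k)).
    apply: connected_cylinder; apply: connected_graph;
    by [apply: IH; rewrite // ltnW|exact: D_Phi_continuous].
  have [x Dx] := D_nonempty kn.
  (* On this line Q_(n+2) = - Q_n, so it stays in [D n.+2 k.+1] while it
     crosses the hypograph, the cylinder and the epigraph. *)
  pose line t := vsnoc (vsnoc x t) (-2) : 'rV[R]_n.+2.
  have cline : connected (range line).
    apply: connected_continuous_connected.
      by apply/connected_intervalP => ? ? _ _ ? _.
    apply: continuous_subspaceT => t.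
    apply: (@cvg_vsnoc _ _ (nbhs t) _ _ (fun t => vsnoc x t) (fun=> -2));
      last exact: cvg_cst.
    by apply: (@cvg_vsnoc _ _ (nbhs t) _ _ (fun=> x) id); [exact: cvg_cst|exact: cvg_id].
  (* The last coordinate [-2] cancels the factor [2 + vlast] of the recurrence. *)
  have Qline t : Q (line t) = - Q x.
    by rewrite Q_rec /line !vsnocK vlast_vsnoc; ring.
  have Qx := D_Q_neq0 Dx.
  have lineD : range line `<=` @D R n.+2 k.+1.
    move=> _ [t _ <-]; apply: bridge_sub_D; rewrite /line !vsnocK //.
    rewrite -/(line t) Qline mulrN oppr_lt0 -expr2.
    by rewrite exprn_even_gt0.
  have Qv t : Q (vinit (line t)) = Q x * (t - Phi x).
    by rewrite Q_Phi /line !vsnocK // vlast_vsnoc.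
  have Q2 : 0 < Q x ^+ 2 by rewrite exprn_even_gt0.
  (* The line already lies in the stratum, so adding it changes nothing, and each piece can be
     attached to it in turn. At [t = Phi x - 1], [Phi x], [Phi x + 1] the middle value is [- Q x],
     [0], [Q x] against the outer value [- Q x], giving points of the epigraph, cylinder and
     hypograph. *)
  rewrite (_ : D k.+1 = range line `|` hypo (@Phi R n.+1) (@D R n.+1 k)
    `|` cylinder (@Gamma R n k) `|` epi (@Phi R n.+1) (@D R n.+1 k.+1)).
    apply: connectedU => //; last apply: connectedU => //; last apply: connectedU => //.
    + exists (line (Phi x - 1)); split; first by do 2!left; exists (Phi x - 1).
      have Dv : D k.+1 (vinit (line (Phi x - 1))).
        by apply: hypo_sub_D; split; rewrite /line !vsnocK ?vlast_vsnoc ?gtrDl ?ltrN10.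
      split=> //; rewrite -Q_mul_gt0 ?(D_Q_neq0 Dv) // Qv Qline; nra.
    + exists (line (Phi x)); split; first by left; exists (Phi x).
      by split; rewrite /line !vsnocK ?vlast_vsnoc.
    + exists (line (Phi x + 1)); split; first by exists (Phi x + 1).
      have Dv : D k (vinit (line (Phi x + 1))).
        by apply: epi_sub_D; split; rewrite /line !vsnocK ?vlast_vsnoc ?ltrDl.
      split=> //; rewrite -Q_mul_lt0 ?(D_Q_neq0 Dv) // Qv Qline; nra.
  rewrite D_SS_S -!setUA; apply/esym/setUidPr => mu /lineD.
  by rewrite D_SS_S -!setUA.
Qed.

Lemma connected_Gamma n k : (k <= n)%N -> connected (@Gamma R n k).
Proof.
by move=> kn; apply: connected_graph; [exact: connected_D|exact: D_Phi_continuous].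
Qed.

(** * Unboundedness of the strata *)

Lemma norm_vlast n (mu : 'rV[R]_n.+1) : `|vlast mu| <= `|mu|.
Proof.
have -> : `|mu| = mx_norm mu by [].
rewrite mx_normrE; exact: (le_bigmax _ (fun i => `|mu i.1 i.2|) (0, ord_max)).
Qed.

(** Each stratum contains a vertical ray, upward for index 0 and downward otherwise. The offset by
    the absolute value of [Phi x] puts the chosen point both on the ray and beyond the bound [M]. *)
Lemma unbounded_D n k : (k <= n.+1)%N -> ~ bounded_set (@D R n.+1 k).
Proof.
move=> kn /ex_strict_bound_gt0[M M0 DM].
have {}DM (mu : 'rV[R]_n.+1) : D k mu -> `|vlast mu| < M.
  move=> Dmu; have muM : `|mu| < M := DM _ Dmu.
  exact: le_lt_trans (norm_vlast _) muM.
case: k kn DM => [|k] kn DM.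
  have [x Dx] := @D_nonempty n 0 isT.
  have /DM : D 0 (vsnoc x (M + `|Phi x|)).
    apply: epi_sub_D; split; rewrite ?vsnocK ?vlast_vsnoc //.
    by have := ler_norm (Phi x); lra.
  by rewrite vlast_vsnoc ltr_norml => /andP[_]; have := normr_ge0 (Phi x); lra.
have [x Dx] := @D_nonempty n k kn.
have /DM : D k.+1 (vsnoc x (- M - `|Phi x|)).
  apply: hypo_sub_D; split; rewrite ?vsnocK ?vlast_vsnoc //.
  by have := ler_normlW (lexx `|- Phi x|); rewrite normrN; lra.
by rewrite vlast_vsnoc ltr_norml => /andP[+ _]; have := normr_ge0 (Phi x); lra.
Qed.

(** * Graphs of smooth functions as submanifolds *)

Definition shear n (f : 'rV[R]_n -> R) (mu : 'rV[R]_n.+1) : 'rV[R]_n.+1 :=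
  vsnoc (vinit mu) (vlast mu + f (vinit mu)).

Lemma shearK n (f : 'rV[R]_n -> R) :
  cancel (shear f) (shear (fun x => - f x)).
Proof.
by move=> mu; rewrite /shear !vsnocK vlast_vsnoc addrK vsnoc_vinit.
Qed.

Lemma shearNK n (f : 'rV[R]_n -> R) :
  cancel (shear (fun x => - f x)) (shear f).
Proof.
by move=> mu; rewrite /shear !vsnocK vlast_vsnoc subrK vsnoc_vinit.
Qed.

Lemma shear_smooth n (f : 'rV[R]_n -> R) U : open U ->
  smooth U (f \o @vinit R n) -> smooth_map U (shear f).
Proof.
move=> oU sf j; rewrite (_ : (fun mu => _) = (fun mu =>
    oapp (vinit mu 0) (vlast mu + f (vinit mu)) (insub (j : nat)))); last first.
  by apply/funext => mu; rewrite mxE.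
case: insub => [i|] /=.
  by apply: (smooth_vinit (phi := id)) => i'; exact: smooth_coord.
by apply: smoothD => //; exact: smooth_coord.
Qed.

Lemma graph_submanifold n (f : 'rV[R]_n -> R) (A : set 'rV[R]_n) : open A ->
  smooth (cylinder A) (f \o @vinit R n) -> smooth_submanifold n (graph f A).
Proof.
move=> oA sf; split; first exact: leqnSn.
have oU := open_cylinder oA.
have sNf : smooth (cylinder A) ((fun x => - f x) \o @vinit R n).
  have := smoothB oU (smooth_cst _ 0) sf.
  by rewrite (_ : (fun x => _) = (fun x => - f x) \o @vinit R n) //;
    apply/funext => x /=; rewrite sub0r.
(* A single chart serves all points: the shear by [- f] maps the cylinder to itself and the graph to
   the slice where the last coordinate is 0. *)
move=> p [Ap _]; exists (cylinder A), (cylinder A), (shear (fun x => - f x)).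
split=> //.
  split=> //.
  - split.
    + by move=> mu Amu; rewrite /cylinder /= /shear vsnocK.
    + by move=> mu nu _ _ /(can_inj (@shearNK _ f)).
    + move=> mu Amu; exists (shear f mu); last exact: shearK.
      by rewrite /cylinder /= /shear vsnocK.
  - exact: shear_smooth.
  - by exists (shear f); split; [exact: shear_smooth|move=> mu _; exact: shearNK].
apply/seteqP; split=> mu.
  move=> [nu [[Anu e] _] <-]; split; first by rewrite /cylinder /= /shear vsnocK.
  move=> i ni; rewrite (_ : i = ord_max); last first.
    by apply/val_inj/eqP; rewrite eqn_leq ni -ltnS ltn_ord.
  by rewrite -/(vlast _) vlast_vsnoc e subrr.
move=> [Amu /(_ ord_max (leqnn _)) mu0]; exists (shear f mu); last exact: shearK.
split; last by rewrite /cylinder /= /shear vsnocK.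
by split; rewrite /shear vsnocK // vlast_vsnoc /vlast mu0 add0r.
Qed.

Lemma Gamma_smooth_surface n k : (k <= n)%N -> smooth_surface n (@Gamma R n k).
Proof.
move=> kn; split; last 1 first.
- apply: graph_submanifold; first exact: open_D.
  apply: (smooth_Phi (phi := @vinit R n)).
  + exact/open_cylinder/open_D.
  + by move=> mu; exact: D_Q_neq0.
  + by apply: (smooth_vinit (phi := id)) => i; exact: smooth_coord.
- have [x Dx] := D_nonempty kn; exists (vsnoc x (Phi x)).
  by split; rewrite vsnocK ?vlast_vsnoc.
- exact: connected_Gamma.
Qed.

(** * Strata as connected components *)

Lemma D_component n k : (k <= n)%N ->
  is_component (~` [set mu : 'rV[R]_n | Q mu = 0]) (D k).
Proof.
move=> kn; have [x Dx] := D_nonempty kn.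
exists x; first exact/eqP/(D_Q_neq0 Dx).
(* The other strata together form an open set disjoint from [D k], so [D k] is clopen in the
   complement. *)
pose C' := \bigcup_(j in [set j | j != k]) @D R n j.
rewrite (_ : ~` _ = D k `|` C'); last first.
  apply/seteqP; split=> mu; last first.
    by move=> [|[j _]] /D_Q_neq0 /eqP.
  move=> /eqP /D_cover[j _ Dj].
  by have [<-|jk] := eqVneq j k; [left|right; exists j].
rewrite connected_component_clopen //.
- exact: open_D.
- by apply: bigcup_open => j _; exact: open_D.
- apply/seteqP; split=> mu // [Dk [j /= jk Dj]].
  by rewrite (D_inj Dj Dk) eqxx in jk.
- exact: connected_D.
Qed.

End Topology.

(* The dimension n >= 1 of the text is n.+1 here. *)
Theorem corollary4p2 (R : realType) (n : nat) :
  let V : set 'rV[R]_n.+1 := [set mu | Q mu = 0] in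
  [/\ V = \bigcup_(k in `I_n.+1) @Gamma R n k,
      trivIset `I_n.+1 (@Gamma R n) &
      forall k : nat, (k < n.+1)%N -> smooth_surface n (@Gamma R n k)]
  /\
  [/\ ~` V = \bigcup_(k in `I_n.+2) @D R n.+1 k,
      trivIset `I_n.+2 (@D R n.+1) &
      forall k : nat, (k < n.+2)%N ->
        [/\ open (@D R n.+1 k),
            is_component (~` V) (@D R n.+1 k) &
            ~ bounded_set (@D R n.+1 k)]].
Proof.
move=> V; split; split.
- apply/seteqP; split=> mu; last by move=> [k _ /Gamma_Q_eq0].
  (* At a zero of [Q] the previous value is nonzero, so the truncated point lies in some stratum and
     the zero lies on the graph over it. *)
  move=> Q0; have Qv := Q_consecutive Q0.
  have [k kn Dk] := D_cover Qv; exists k => //; split=> //.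
  by apply/eqP; rewrite -Q_eq0 // Q0.
- by move=> k l _ _ [mu [[Dk _] [Dl _]]]; exact: D_inj Dk Dl.
- by move=> k kn; exact: Gamma_smooth_surface.
- apply/seteqP; split=> mu; last by move=> [k _ /D_Q_neq0 /eqP].
  by move=> /eqP /D_cover[k kn Dk]; exists k.
- by move=> k l _ _ [mu [Dk Dl]]; exact: D_inj Dk Dl.
- move=> k kn; split; [exact: open_D|exact: D_component|exact: unbounded_D].
Qed.
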